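(* Let $\ell$ be prime and let $N_{\ell}:=(\ell^6-2\ell^5+2\ell^4-3\ell^2+2\ell)/24$. If $n>N_\ell$, then every $\ell$-core partition of $n$ has a part that is a multiple of $\ell$.
   Context: The hook length of the cell $(k,j)$ in the Young diagram of a partition $\lambda$ is $h_\lambda(k,j)=(\lambda_k-k)+(\lambda'_j-j)+1$, where $\lambda'_j$ is the number of cells in column $j$; $\lambda$ is an $\ell$-core if none of its hook lengths is a multiple of $\ell$. *)

(* Defs.v *)
From mathcomp Require Import all_boot all_order all_algebra.

Set Implicit Arguments.
Unset Strict Implicit.
Unset Printing Implicit Defensive.

Import GRing.Theory.

(* Rows and columns are numbered from 1. *)

Definition is_partition_of (n : nat) (la : seq nat) : Prop :=
  [/\ sorted geq la, all (fun p => 0 < p) la & sumn la = n].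

Definition part (la : seq nat) (k : nat) : nat := nth 0 la k.-1.

Definition in_diagram (la : seq nat) (k j : nat) : bool :=
  (1 <= k <= size la) && (1 <= j <= part la k).

Definition column_length (la : seq nat) (j : nat) : nat :=
  count (fun k => in_diagram la k j) (iota 1 (size la)).

(* Integer-valued because la_k - k can be negative on a cell of the diagram. *)
Definition hook_length (la : seq nat) (k j : nat) : int :=
  (((part la k)%:Z - k%:Z) + ((column_length la j)%:Z - j%:Z) + 1)%R.

Definition is_core (l : nat) (la : seq nat) : Prop :=
  forall k j : nat, in_diagram la k j -> ~~ (l%:Z %| hook_length la k j)%Z.

Definition core_bound (l : nat) : rat :=
  let x : rat := (l%:R)%R in
  ((x ^+ 6 - 2%:R * x ^+ 5 + 2%:R * x ^+ 4 - 3%:R * x ^+ 2 + 2%:R * x)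
     / 24%:R)%R.

(* Main.v *)
(* Place the beta-numbers (first-column hook lengths) of the core on an abacus
   with [l] runners.  Being a core means that every runner is flush, so the core
   is determined by the positions [e_i] of the first gaps of the runners, and
   the parts are the numbers of gaps below the beads.  Suppose no [e_k] lies in
   [(e_i, e_i + d]] with [d = l^2 - l + 1], although [e_i] is not the largest.
   Then some runner carries [l] consecutive beads along which the number of gaps
   grows by the constant [m = #{k | e_k <= e_i}], where [0 < m < l]; one of these
   [l] parts is a multiple of the prime [l].  Hence, if no part is a multiple of
   [l], consecutive [e_i] differ by at most [d], and

     4 l^2 n = sum_{i,j} (e_i - e_j)^2 - sum_{i,j} (i - j)^2
            <= (d^2 - 1) sum_{i,j} (i - j)^2 = (d^2 - 1) l^2 (l^2 - 1) / 6,

   so [n <= (d^2 - 1) (l^2 - 1) / 24 = N_l]. *)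

Require Import Defs.
From mathcomp Require Import all_boot all_order all_algebra.
From mathcomp Require Import zify ring lra.

Set Implicit Arguments.
Unset Strict Implicit.
Unset Printing Implicit Defensive.

Import Order.TTheory GRing.Theory Num.Theory.

(** * Beta-numbers, and parts as gap counts *)

Fixpoint beta_set (la : seq nat) : seq nat :=
  if la is p :: la' then p + size la' :: beta_set la' else [::].

Lemma size_beta_set la : size (beta_set la) = size la.
Proof. by elim: la => //= p la ->. Qed.

Lemma nth_beta_set la k : k < size la ->
  nth 0 (beta_set la) k = nth 0 la k + (size la - k.+1).
Proof. by elim: la k => //= p la IH [|k] //= hk; rewrite ?IH //; lia. Qed.

Lemma sorted_beta_set la : sorted geq la -> sorted gtn (beta_set la).
Proof.
elim: la => //= p [|q la] //= IH /andP[qp s].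
by rewrite (IH s) andbT; lia.
Qed.

Lemma uniq_beta_set la : sorted geq la -> uniq (beta_set la).
Proof.
move/sorted_beta_set; apply: sorted_uniq; last by move=> x; rewrite /= ltnn.
by move=> y x z /= yx zy; apply: ltn_trans zy yx.
Qed.

Lemma sum_beta_set la :
  (\sum_(b <- beta_set la) b).*2 = (sumn la).*2 + size la * (size la).-1.
Proof.
elim: la => [|p la IH] /=; first by rewrite big_nil.
by rewrite big_cons doubleD IH; case: (size la) => [|s]; nia.
Qed.

Lemma beta_set_lt_head p la b :
  sorted geq (p :: la) -> b \in beta_set la -> b < p + size la.
Proof.
move/sorted_beta_set => /=; rewrite path_sortedE; last first.
  by move=> y x z /= yx zy; apply: ltn_trans zy yx.
by case/andP=> /allP h _ /h.
Qed.

Definition gaps_below (X : seq nat) (x : nat) : nat :=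
  count (fun y => y \notin X) (iota 0 x).

Lemma count_mem_iota (X : seq nat) x : uniq X ->
  count (fun y => y \in X) (iota 0 x) = count (fun b => b < x) X.
Proof.
move=> uX; rewrite -!size_filter; apply/perm_size/uniq_perm.
- by rewrite filter_uniq ?iota_uniq.
- by rewrite filter_uniq.
- by move=> y; rewrite !mem_filter mem_iota add0n andbC.
Qed.

Lemma gaps_belowE X x : uniq X ->
  gaps_below X x + count (fun b => b < x) X = x.
Proof.
move=> uX; rewrite -count_mem_iota // addnC /gaps_below -[RHS](size_iota 0).
exact: count_predC.
Qed.

(** The beta-number of a part [p] is [p] plus the number of later rows, and those rows carry exactly
    the smaller beta-numbers; removing the beads below [b] from the count leaves [p]. *)
Lemma gaps_below_part la b : sorted geq la -> b \in beta_set la ->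
  gaps_below (beta_set la) b \in la.
Proof.
move=> sla bX; have := gaps_belowE b (uniq_beta_set sla).
suff [p pla e] : exists2 p, p \in la &
    b = p + count (fun c => c < b) (beta_set la).
  by move=> e'; rewrite (_ : gaps_below _ _ = p) //; lia.
elim: la sla bX => //= p la IH sla.
rewrite inE => /orP[/eqP ->|bX].
  exists p; first by rewrite mem_head.
  rewrite ltnn add0n -{1}[size la]size_beta_set; congr (_ + _).
  by apply/esym/eqP; rewrite -all_count; apply/allP=> c; apply: beta_set_lt_head.
have [q qla e] := IH (path_sorted sla) bX.
exists q; first by rewrite inE qla orbT.
by have := beta_set_lt_head sla bX; lia.
Qed.

(** * Hooks as pairs of a bead and a gap *)

Lemma count_iota_lt r s m : r <= s ->
  count (fun k => k < m + r) (iota m s) = r.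
Proof.
move=> rs; rewrite -(subnKC rs) iotaD count_cat.
rewrite (_ : count _ _ = r); last first.
  rewrite -[RHS](size_iota m r); apply/eqP; rewrite -all_count.
  by apply/allP=> k; rewrite mem_iota => /andP[].
rewrite (_ : count _ _ = 0) ?addn0 //; apply/eqP; rewrite -leqn0 leqNgt -has_count.
by apply/hasPn=> k; rewrite mem_iota; lia.
Qed.

(* The hook of a bead [b] and a gap [y < b] lies in the row of [b] and in the
   column numbered by the gaps up to [y]. *)
Lemma hook_of_gap la b y : sorted geq la ->
  b \in beta_set la -> y \notin beta_set la -> y < b ->
  exists k j, in_diagram la k j /\ hook_length la k j = (b%:Z - y%:Z)%R.
Proof.
move=> sla bX yX yb.
set X := beta_set la in bX yX *; set s := size la.
have sX : size X = s by rewrite size_beta_set.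
have dX i j : i <= j -> j < s -> nth 0 X j + (j - i) <= nth 0 X i.
  move=> ij js; rewrite !nth_beta_set //; last by lia.
  have : nth 0 la j <= nth 0 la i.
    have geq_tr : transitive geq by move=> u v w /= uv wu; apply: leq_trans wu uv.
    have geq_rf : reflexive geq by move=> u /=.
    by apply: (sorted_leq_nth geq_tr geq_rf 0 sla); rewrite ?inE //; lia.
  by lia.
(* Beads are listed in decreasing order, so the first [r] of them are exactly those above [y]. *)
pose r := find (fun c => c < y) X.
have rs : r <= s by rewrite -sX find_size.
have big_r i : i < r -> y < nth 0 X i.
  move=> ir; have := before_find 0 ir => /=.
  have : nth 0 X i \in X by rewrite mem_nth ?sX; lia.
  by case: (ltngtP y (nth 0 X i)) => // e; rewrite -e (negPf yX).
have small_r i : r <= i -> i < s -> nth 0 X i < y.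
  move=> ri is_; have hr : has (fun c => c < y) X by rewrite has_find sX -/r; lia.
  by have := nth_find 0 hr; rewrite -/r; have := dX _ _ ri is_; lia.
(* The [s - r] beads below [y] are distinct naturals; hence the subtraction in [j] does not
   truncate. *)
have yr : s <= y + r.
  case: (ltnP r s) => [lrs|]; last by lia.
  have := small_r s.-1; have := dX r s.-1; have := small_r r (leqnn r) lrs; lia.
(* There are [y - (s - r)] gaps below [y], and columns are numbered from 1. *)
pose j := (y + r).+1 - s.
have bs : index b X < s by rewrite -sX index_mem.
have bk : nth 0 X (index b X) = b by rewrite nth_index.
have partj k : k < s -> (j <= nth 0 la k) = (k < r).
  move=> ks; have := nth_beta_set ks; rewrite -/X -/s => e.
  case: (ltnP k r) => kr.
    have : nth 0 X r.-1 + (r.-1 - k) <= nth 0 X k by apply: dX; lia.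
    have : y < nth 0 X r.-1 by apply: big_r; lia.
    by rewrite /j; lia.
  have : nth 0 X k + (k - r) <= nth 0 X r by apply: dX; lia.
  by have : nth 0 X r < y by [apply: small_r; lia]; rewrite /j; lia.
have kr : index b X < r.
  by rewrite ltnNge; apply/negP => h; have := small_r _ h bs; lia.
have col : column_length la j = r.
  rewrite /column_length -/s -[RHS](count_iota_lt 1 rs).
  apply: eq_in_count => k; rewrite mem_iota => hk.
  rewrite /in_diagram /part -/s partj; last by lia.
  by rewrite /j; lia.
exists (index b X).+1, j; split.
  by rewrite /in_diagram /part /= -/s partj // kr bs /j; lia.
rewrite /hook_length col /part /=.
by have := nth_beta_set bs; rewrite -/X bk -/s /j; lia.
Qed.

(** Otherwise the bead [b] and the gap [b - l] would give a hook of length exactly [l]. *)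
Lemma core_beta_set l la b : sorted geq la -> is_core l la -> 0 < l ->
  b \in beta_set la -> l <= b -> b - l \in beta_set la.
Proof.
move=> sla core l0 bX lb; apply/negPn/negP => yX.
have [|k [j [kj hk]]] := hook_of_gap sla bX yX; first by lia.
have /negP[] := core _ _ kj; rewrite hk.
by rewrite (_ : (_ - _)%R = Posz l) ?dvdzz //; lia.
Qed.

(** * Flush runners of the abacus *)

Lemma mem_down_closed (s : seq nat) x : uniq s ->
  (forall y, y.+1 \in s -> y \in s) -> (x \in s) = (x < size s).
Proof.
move=> us dc.
have dcD d y : y + d \in s -> y \in s.
  by elim: d => [|d IH]; rewrite ?addn0 // addnS => /dc.
apply/idP/idP => [xs|].
  rewrite -(size_iota 0 x.+1); apply: uniq_leq_size; first exact: iota_uniq.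
  move=> y; rewrite mem_iota add0n => yx; apply: (dcD (x - y)).
  by rewrite subnKC //; lia.
apply: contraTT => xs; rewrite -leqNgt -(size_iota 0 x).
apply: uniq_leq_size => // y ys; rewrite mem_iota add0n /= ltnNge.
by apply: contra xs => xy; apply: (dcD (y - x)); rewrite subnKC.
Qed.

Definition runner (l : nat) (X : seq nat) (i : nat) : seq nat :=
  [seq b <- X | b %% l == i].

(** On a flush runner the beads fill [i, i + l, ...] without holes, so this is its least free
    position. *)
Definition first_gap (l : nat) (X : seq nat) (i : nat) : nat :=
  i + l * size (runner l X i).

Lemma dvdn_arith_progression l m g : 0 < l -> coprime m l ->
  exists2 t, t < l & l %| g + t * m.
Proof.
move=> l0 cml; have [a _] := Bezoutr m l0; rewrite (eqP cml) => la.
(* Here [l] divides [1 + a * m], hence also [g * (1 + a * m)]. *)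
exists (g * a %% l); first by rewrite ltn_mod.
rewrite /dvdn -modnDmr modnMml modnDmr.
by rewrite -mulnA -[g in g + _]muln1 -mulnDr -/(dvdn _ _) dvdn_mull.
Qed.

Section FlushAbacus.

Variables (l : nat) (X : seq nat).
Hypotheses (l_gt0 : 0 < l) (X_uniq : uniq X).
Hypothesis X_flush : forall b, b \in X -> l <= b -> b - l \in X.

Local Notation e := (first_gap l X).

Lemma perm_runner i : i < l ->
  perm_eq (runner l X i) [seq i + l * t | t <- iota 0 (size (runner l X i))].
Proof.
move=> il; pose Q := [seq b %/ l | b <- runner l X i].
have rE b : b \in runner l X i -> b = i + l * (b %/ l).
  by rewrite mem_filter => /andP[/eqP <- _]; rewrite addnC mulnC -divn_eq.
have memQ t : (t \in Q) = (i + l * t \in X).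
  apply/mapP/idP => [[b br ->]|tX].
    by rewrite -rE //; move: br; rewrite mem_filter => /andP[].
  exists (i + l * t).
    by rewrite mem_filter tX addnC mulnC modnMDl modn_small ?eqxx.
  by rewrite addnC mulnC divnMDl // divn_small ?addn0.
have uQ : uniq Q.
  rewrite map_inj_in_uniq ?filter_uniq // => b c br cr bc.
  by rewrite (rE _ br) (rE _ cr) bc.
(* Flushness makes the quotients downward closed, so they form an initial interval. *)
have Qmem t : (t \in Q) = (t < size (runner l X i)).
  rewrite -(size_map (divn^~ l) (runner l X i)); apply: mem_down_closed => // u.
  rewrite !memQ => /X_flush; rewrite (_ : _ - l = i + l * u) => [->//|]; nia.
have -> : runner l X i = [seq i + l * t | t <- Q].
  by rewrite -map_comp -[LHS]map_id; apply/eq_in_map => b /rE.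
apply: perm_map; rewrite size_map; apply: uniq_perm; rewrite ?iota_uniq //.
by move=> t; rewrite Qmem mem_iota add0n size_map.
Qed.

Lemma mem_flush b : (b \in X) = (b < e (b %% l)).
Proof.
have il : b %% l < l by rewrite ltn_mod.
have := perm_mem (perm_runner il) b; rewrite mem_filter eqxx /= => ->.
rewrite /first_gap; set A := size _.
apply/mapP/idP => [[t]|bA].
  by rewrite mem_iota => tA ->; nia.
exists (b %/ l); last by rewrite addnC mulnC -divn_eq.
by rewrite mem_iota; have := divn_eq b l; nia.
Qed.

Lemma first_gap_mod i : i < l -> e i %% l = i.
Proof. by move=> il; rewrite /first_gap addnC mulnC modnMDl modn_small. Qed.

(** * Gap counts along a runner *)

Lemma count_modn_window (P : pred nat) x :
  count (fun y => P (y %% l)) (iota x l) = count P (iota 0 l).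
Proof.
elim: x => [|x <-].
  apply: eq_in_count => y; rewrite mem_iota add0n => yl.
  by rewrite modn_small.
(* Sliding the window by one trades [x] for [x + l], which has the same residue. *)
case: l l_gt0 => // l' _.
by rewrite -[X in iota x.+1 X]addn1 iotaD /= count_cat /= addn0 addSnnS modnDr addnC.
Qed.

(** The window from [x] to [x + l - 1] meets each runner once: at a bead if the first gap lies
    beyond the window, and otherwise at a gap, because [m < x + l]. *)
Lemma gaps_below_step m x : (forall i, i < l -> e i <= m \/ x + l <= e i) ->
  m < x + l ->
  gaps_below X (x + l) = gaps_below X x + count (fun i => e i <= m) (iota 0 l).
Proof.
move=> far mx; rewrite /gaps_below iotaD count_cat add0n; congr (_ + _).
rewrite -(count_modn_window (fun i => e i <= m) x).
apply: eq_in_count => y; rewrite mem_iota mem_flush -leqNgt => yx.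
have := divn_eq y l; have il : y %% l < l by rewrite ltn_mod.
case: (far _ il); rewrite /first_gap; last by lia.
move=> em ey; rewrite em; case: (leqP (size (runner l X (y %% l))) (y %/ l)); nia.
Qed.

Lemma next_first_gap i j : prime l -> i < l -> j < l -> e i < e j ->
  (forall b, b \in X -> ~~ (l %| gaps_below X b)) ->
  exists2 k, k < l & e i < e k <= e i + (l * l - l + 1).
Proof.
move=> l_prime il jl eij nodvd.
case: (boolP (has (fun k => e i < e k <= e i + (l * l - l + 1)) (iota 0 l))).
  by case/hasP=> k; rewrite mem_iota; exists k.
move/hasPn=> nok; exfalso.
have far k : k < l -> e k <= e i \/ e i + (l * l - l + 1) < e k.
  by move=> kl; have := nok k; rewrite mem_iota add0n kl => /(_ isT); lia.
(* A window of [l * l] positions holding [l] beads of one runner, along which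
   the gap count grows by a constant prime to [l]. *)
have hit x0 : e i < e (x0 %% l) -> e i < x0 + l -> x0 <= (e i).+1 -> False.
  move=> ex xl xi.
  set m := count (fun k => e k <= e i) (iota 0 l).
  have m_gt0 : 0 < m.
    by rewrite -has_count; apply/hasP; exists i; rewrite ?mem_iota.
  have m_lt : m < l.
    rewrite -[X in _ < X](size_iota 0 l) ltn_neqAle count_size andbT -all_count.
    apply/allPn; exists j; first by rewrite mem_iota.
    by rewrite -ltnNge.
  (* The last position used is [x0 + (l - 1) * l], at most [e i + (l * l - l + 1)], so it lies below
     every first gap exceeding [e i]; this dictates the constant. *)
  have Gt t : t < l -> gaps_below X (x0 + t * l) = gaps_below X x0 + t * m.
    elim: t => [|t IH] tl; first by rewrite !mul0n !addn0.
    rewrite mulSn addnCA addnC (gaps_below_step (m := e i)).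
    - by rewrite IH ?(ltnW tl) // -/m; lia.
    - by move=> k /far [|?]; [left|right; nia].
    - by lia.
  have [|t tl] := dvdn_arith_progression (gaps_below X x0) l_gt0 (m := m).
    by rewrite coprime_sym prime_coprime // gtnNdvd.
  rewrite -Gt //; apply/negP/nodvd; rewrite mem_flush addnC modnMDl.
  by case: (far (x0 %% l)); rewrite ?ltn_mod //; nia.
(* If [e i + 1] is a bead, its own runner serves; otherwise runner [j] does, from its last position
   up to [e i + 1]. *)
case: (boolP ((e i).+1 \in X)) => [|gap].
  by rewrite mem_flush => h; apply: (hit (e i).+1); lia.
(* The runner of the gap [e i + 1] has its first gap at most [e i] and congruent to [e i + 1], hence
   at least [l] below [e i + 1]. So runner [j] has a position up to [e i + 1]. *)
have li : l <= (e i).+1.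
  move: gap; rewrite mem_flush -leqNgt.
  have kl : (e i).+1 %% l < l by rewrite ltn_mod.
  have := divn_eq (e i).+1 l; case: (far _ kl); last by lia.
  move: (e i) kl => E kl; rewrite /first_gap.
  by case: (E.+1 %/ l) => [|q]; nia.
have := divn_eq ((e i).+1 - j) l.
have : ((e i).+1 - j) %% l < l by rewrite ltn_mod.
set q := _ %/ _; set r := _ %% _ => rl qr.
have xE : (e i).+1 - r = q * l + j by lia.
apply: (hit ((e i).+1 - r)); [|lia..].
by rewrite xE modnMDl modn_small.
Qed.

(** * Power sums of the first gaps *)

Lemma first_gap_inj (i j : 'I_l) : e i = e j -> i = j.
Proof.
by move=> eij; apply: val_inj; rewrite /= -(first_gap_mod (ltn_ord i)) eij first_gap_mod.
Qed.

Lemma sum_runner (F : nat -> nat) :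
  \sum_(b <- X) F b = \sum_(i < l) \sum_(b <- runner l X i) F b.
Proof.
under [RHS]eq_bigr do rewrite big_filter big_mkcond.
rewrite exchange_big; apply: eq_bigr => b _ /=.
have bl : b %% l < l by rewrite ltn_mod.
by rewrite -big_mkcond (big_pred1 (Ordinal bl)) // => i; rewrite eq_sym.
Qed.

(** Telescoping of [(b + l) ^ 2 - b ^ 2 = 2 * l * b + l ^ 2] along the beads, from [i] up to
    [e i]. *)
Lemma sum_one_runner i : i < l ->
  l * (\sum_(b <- runner l X i) b).*2 + i ^ 2 + l ^ 2 * size (runner l X i)
    = e i ^ 2.
Proof.
move=> il; rewrite (perm_big _ (perm_runner il)) big_map /first_gap /=.
elim: (size _) => [|A IH]; first by rewrite big_nil muln0 addn0; nia.
rewrite -addn1 iotaD big_cat /= big_seq1 add0n doubleD.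
by move: IH; set S := \sum_(_ <- _) _; nia.
Qed.

Lemma sum_first_gap : \sum_(i < l) e i = \sum_(i < l) i + l * size X.
Proof.
rewrite -(sum1_size X) sum_runner big_distrr -big_split /=.
by apply: eq_bigr => i _; rewrite sum1_size.
Qed.

Lemma sum_first_gap_sq :
  \sum_(i < l) e i ^ 2
    = l * (\sum_(b <- X) b).*2 + \sum_(i < l) i ^ 2 + l ^ 2 * size X.
Proof.
rewrite -(sum1_size X) !sum_runner -mul2n !big_distrr -!big_split /=.
by apply: eq_bigr => i _; rewrite sum1_size -sum_one_runner // mul2n.
Qed.

End FlushAbacus.

(** * Square sums over pairs, and the size of a core *)

Local Open Scope ring_scope.

(** This is [2 * l ^ 2] times the variance of [f], written over ordered pairs so that two functions
    can be compared termwise. *)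
Definition spread (R : nzRingType) (l : nat) (f : 'I_l -> nat) : R :=
  \sum_i \sum_j ((f i)%:R - (f j)%:R) ^+ 2.

Lemma spreadE (R : comNzRingType) l (f : 'I_l -> nat) :
  spread R f = 2 * l%:R * (\sum_i f i ^ 2)%:R - 2 * (\sum_i f i)%:R ^+ 2.
Proof.
rewrite /spread !natr_sum; under [X in 2 * _ * X]eq_bigr do rewrite natrX.
set S := \sum_i (f i)%:R; set Q := \sum_i (f i)%:R ^+ 2.
have row (i : 'I_l) : \sum_j ((f i)%:R - (f j)%:R) ^+ 2
    = l%:R * (f i)%:R ^+ 2 + Q - 2 * S * (f i)%:R :> R.
  rewrite (eq_bigr (fun j => (f i)%:R ^+ 2 + (f j)%:R ^+ 2
                             + (- (2 * (f i)%:R)) * (f j)%:R)); last first.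
    by move=> j _; ring.
  rewrite !big_split sumr_const /= -mulr_sumr card_ord -/Q -/S -[_ *+ l]mulr_natl; ring.
rewrite (eq_bigr _ (fun i _ => row i)) sumrB big_split sumr_const /=.
by rewrite -!mulr_sumr card_ord -/Q -/S -[_ *+ l]mulr_natl; ring.
Qed.

(* Comparison with the rank function, which is a permutation of [0, l). *)
Lemma spread_le (R : realDomainType) l d (f : 'I_l -> nat) : injective f ->
  (forall i j, (f i < f j)%N -> exists k, (f i < f k <= f i + d)%N) ->
  spread R f <= d%:R ^+ 2 * spread R (@nat_of_ord l).
Proof.
move=> f_inj next.
pose below i := [set k | (f k < f i)%N].
have below_lt i j : (f i < f j)%N -> (#|below i| < #|below j|)%N.
  move=> ij; apply/proper_card/properP; split.
    by apply/subsetP=> k; rewrite !inE => /ltn_trans; apply.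
  by exists i; rewrite !inE ?ltnn.
have below_l i : (#|below i| < l)%N.
  rewrite -[X in (_ < X)%N]card_ord -cardsT; apply/proper_card/properP; split=> //.
  by exists i; rewrite !inE ?ltnn.
pose rk i := Ordinal (below_l i).
have rk_inj : injective rk.
  move=> i j [] eij; apply: f_inj; case: (ltngtP (f i) (f j)) => // /below_lt;
  by rewrite eij ltnn.
(* Climb from [f i] to [f j] in steps of at most [d], each raising the rank by at least one. If a
   step overshoots [f j], the remaining distance is below [d] and one rank pays for it. *)
have f_rk N i j : (f j < f i + N)%N -> (f i <= f j)%N ->
    (f j <= f i + d * (rk j - rk i))%N /\ (rk i <= rk j)%N.
  elim: N i => [|N IH] i jN; first by lia.
  rewrite leq_eqVlt => /orP[/eqP/f_inj ->|ij]; first by lia.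
  have rij : (rk i < rk j)%N by apply: below_lt.
  have [k /andP[ik kd]] := next _ _ ij.
  split; last by lia.
  case: (leqP (f k) (f j)) => kj; last by nia.
  have rik : (rk i < rk k)%N by apply: below_lt.
  have [||h ?] := IH k; [lia|by []|].
  have := leq_mul2l d 1 (rk k - rk i); rewrite subn_gt0 rik orbT muln1 => hd.
  have : (d * (rk j - rk i) = d * (rk j - rk k) + d * (rk k - rk i))%N.
    by rewrite -mulnDr; congr muln; lia.
  by lia.
(* As [rk] is a permutation, the right side becomes a sum over differences of ranks. *)
rewrite /spread mulr_sumr [leRHS](reindex_inj rk_inj) /=.
apply: ler_sum => i _; rewrite mulr_sumr [leRHS](reindex_inj rk_inj).
apply: ler_sum => j _.
wlog ij : i j / (f i <= f j)%N.
  move=> wl; case: (leqP (f i) (f j)) => [|/ltnW] /wl //.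
  by rewrite -[X in X ^+ 2]opprB sqrrN -[X in _ * X ^+ 2]opprB sqrrN.
have [|h1 h2] := f_rk (f j).+1 i j _ ij; first by lia.
rewrite -opprB sqrrN -[X in _ * X ^+ 2]opprB sqrrN -exprMn -!natrB //.
by rewrite -natrM -!natrX ler_nat leq_sqr leq_subLR.
Qed.

Lemma double_sum_ord (R : comNzRingType) l :
  2 * (\sum_(i < l) i)%:R = l%:R * (l%:R - 1) :> R.
Proof.
elim: l => [|l IH]; first by rewrite big_ord0; ring.
by rewrite big_ord_recr /= natrD mulrDr IH -natr1; ring.
Qed.

Lemma spread_ord (R : numFieldType) l :
  6 * spread R (@nat_of_ord l) = l%:R ^+ 2 * (l%:R ^+ 2 - 1).
Proof.
have S2 : 6 * (\sum_(i < l) i ^ 2)%:R = l%:R * (l%:R - 1) * (2 * l%:R - 1) :> R.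
  elim: l => [|l IH]; first by rewrite big_ord0; ring.
  by rewrite big_ord_recr /= natrD mulrDr IH natrX -natr1; ring.
rewrite spreadE.
have -> : 6 * (2 * l%:R * (\sum_(i < l) i ^ 2)%:R - 2 * (\sum_(i < l) i)%:R ^+ 2)
  = 2 * l%:R * (6 * (\sum_(i < l) i ^ 2)%:R)
    - 3 * (2 * (\sum_(i < l) i)%:R) ^+ 2 :> R by ring.
by rewrite double_sum_ord S2; ring.
Qed.

(** Both power sums of the first gaps involve the number of beads, but it cancels in [spreadE]
    because the residues sum to [l * (l - 1) / 2]. *)
Lemma core_size_spread (l : nat) (la : seq nat) :
  (0 < l)%N -> sorted geq la -> is_core l la ->
  4 * l%:R ^+ 2 * (sumn la)%:R
    = spread rat (fun i : 'I_l => first_gap l (beta_set la) i)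
      - spread rat (@nat_of_ord l).
Proof.
move=> l0 sla core; set X := beta_set la.
have uX : uniq X := uniq_beta_set sla.
have fX b : b \in X -> (l <= b)%N -> (b - l)%N \in X by apply: core_beta_set.
rewrite !spreadE sum_first_gap // (sum_first_gap_sq l0 uX fX) sum_beta_set.
rewrite size_beta_set !(natrD, natrM, natrX) -!muln2 !natrM.
have -> : (size la)%:R * (size la).-1%:R = (size la)%:R * ((size la)%:R - 1) :> rat.
  by case: (size la) => [|s] /=; rewrite ?mul0r // -natr1; ring.
move: (double_sum_ord rat l).
move: (\sum_(i < l) i)%:R (\sum_(i < l) i ^ 2)%:R => S Q hS.
have -> : S = l%:R * (l%:R - 1) / 2 by rewrite -hS; field.
by field.
Qed.

Lemma core_size_le (l : nat) (la : seq nat) :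
  prime l -> sorted geq la -> is_core l la ->
  (forall p, p \in la -> ~~ (l %| p)%N) -> (sumn la)%:R <= core_bound l.
Proof.
move=> l_prime sla la_core nodvd; have l0 := prime_gt0 l_prime.
set X := beta_set la.
have uX : uniq X := uniq_beta_set sla.
have fX b : b \in X -> (l <= b)%N -> (b - l)%N \in X by apply: core_beta_set.
pose d := (l * l - l + 1)%N.
have : spread rat (fun i : 'I_l => first_gap l X i)
    <= d%:R ^+ 2 * spread rat (@nat_of_ord l).
  apply: spread_le => [i j|i j ij]; first exact: first_gap_inj.
  have [|k kl hk] := next_first_gap l0 uX fX l_prime (ltn_ord i) (ltn_ord j) ij.
    by move=> b /(gaps_below_part sla) /nodvd.
  by exists (Ordinal kl).
have := core_size_spread l0 sla la_core; have := spread_ord rat l.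
have dE : d%:R = l%:R ^+ 2 - l%:R + 1 :> rat.
  by rewrite /d natrD natrB ?natrM ?leq_pmull // expr2.
rewrite dE /core_bound -/X.
have : 0 < l%:R :> rat by rewrite ltr0n.
move: (l%:R : rat) ((sumn la)%:R : rat) (spread _ _) (spread _ _).
move=> x N S T x0 hT hN hS.
have x2 : 0 < x ^+ 2 by rewrite exprn_gt0.
have hT' : T = x ^+ 2 * (x ^+ 2 - 1) / 6 by rewrite -hT; field.
(* Subtracting [T], the spread of the residues, turns the factor [d ^ 2] into [d ^ 2 - 1]. *)
have : 4 * x ^+ 2 * N <= ((x ^+ 2 - x + 1) ^+ 2 - 1) * (x ^+ 2 * (x ^+ 2 - 1) / 6).
  by rewrite hN -hT'; lra.
have -> : ((x ^+ 2 - x + 1) ^+ 2 - 1) * (x ^+ 2 * (x ^+ 2 - 1) / 6) =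
  4 * x ^+ 2 * ((x ^+ 6 - 2%:R * x ^+ 5 + 2%:R * x ^+ 4 - 3%:R * x ^+ 2 + 2%:R * x) / 24%:R).
  by field.
by rewrite ler_pM2l // mulr_gt0.
Qed.

Local Close Scope ring_scope.

Theorem theorem4p1 (l n : nat) (la : seq nat) (l_prime : prime l)
  (n_gt : (core_bound l < n%:R)%R)
  (la_part : is_partition_of n la) (la_core : is_core l la) :
  exists2 p : nat, p \in la & l %| p.
Proof.
case: la_part => sla _ n_sum.
case: (boolP (has (dvdn l) la)) => [/hasP[p pla lp]|/hasPn nodvd]; first by exists p.
by have := core_size_le l_prime sla la_core nodvd; rewrite n_sum leNgt n_gt.
Qed.
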